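(* Let $\alpha\in\mathbb R\setminus\mathbb Q$. For any $\psi:\mathbb N\to\mathbb N$ with $\psi(n)=o(n)$, there exists a residual subset $\mathcal R$ of $\mathcal C_0(\mathbb T)$ such that, for any $f\in\mathcal R$, the set $$\mathcal F_\psi(f)=\left\{x\in\mathbb T:\ \limsup_{n\to\infty}\frac{|S_{n,\alpha}f(x)|}{\psi(n)}<+\infty\right\}$$ satisfies $\dim_{\mathcal H}(\mathcal F_\psi(f))=0$.
   Context: $\mathbb N=\{1,2,3,\dots\}$; $\mathbb T=\mathbb R/\mathbb Z$ with its usual metric. Fix a scalar field, $\mathbb R$ or $\mathbb C$ (either is allowed). $\mathcal C_0(\mathbb T)$ is the space of continuous scalar-valued functions on $\mathbb T$ with zero mean for Lebesgue measure, equipped with the sup norm. $S_{n,\alpha}f(x)=\sum_{k=0}^{n-1}f(x+k\alpha)$. $\dim_{\mathcal H}$ denotes Hausdorff dimension (with the dimension of the empty set taken to be $0$). A subset of a complete metric space is residual if it contains a countable intersection of dense open sets. *)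

(* Defs.v *)
From HB Require Import structures.
From mathcomp Require Import all_boot all_order all_algebra.
From mathcomp Require Import complex.
From mathcomp Require Import all_classical all_reals all_analysis.

Set Implicit Arguments.
Unset Strict Implicit.
Unset Printing Implicit Defensive.

Import Order.TTheory GRing.Theory Num.Theory.
Import numFieldNormedType.Exports.

Local Open Scope classical_set_scope.
Local Open Scope ring_scope.
Local Open Scope quotient_scope.

Section Circle.
Context {R : realType}.

Definition circle : Type :=
  Quotient.quot (GRing.ZmodClosed.clone R (@Num.int_num_subdef R) _).

HB.instance Definition _ := Choice.on circle.
HB.instance Definition _ := GRing.Zmodule.on circle.
HB.instance Definition _ := EqQuotient.on circle.

Definition to_circle (t : R) : circle := \pi_circle t.

Lemma to_circle_eq (s t : R) :
  (to_circle s == to_circle t) = (s - t \is a Num.int).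
Proof. by rewrite [LHS]piE. Qed.

Lemma to_circleD : {morph to_circle : s t / s + t}.
Proof. move=> s t; exact: (@Quotient.pi_add R (GRing.ZmodClosed.clone R (@Num.int_num_subdef R) _)). Qed.

Lemma to_circleN : {morph to_circle : s / - s}.
Proof. move=> s; exact: (@Quotient.pi_opp R (GRing.ZmodClosed.clone R (@Num.int_num_subdef R) _)). Qed.

Lemma to_circle0 : to_circle 0 = 0.
Proof. by rewrite -(subrr 0) to_circleD to_circleN subrr. Qed.

Lemma to_circle_surj (x : circle) : exists t, to_circle t = x.
Proof. by exists (repr x); rewrite /to_circle reprK. Qed.

(* The quotient norm on R / Z, i.e. the distance from a lift to the integers. *)
Definition circle_norm (x : circle) : R :=
  inf [set `|t| | t in [set t | to_circle t = x]].

Let norms (x : circle) : set R := [set `|t| | t in [set t | to_circle t = x]].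

Let has_inf_norms x : has_inf (norms x).
Proof.
split; last by exists 0 => _ [t _ <-].
by have [t tx] := to_circle_surj x; exists `|t|, t.
Qed.

Lemma circle_norm_le t : circle_norm (to_circle t) <= `|t|.
Proof. by apply: ge_inf; [case: (has_inf_norms (to_circle t))|exists t]. Qed.

Lemma circle_norm_lift x (e : R) : circle_norm x < e ->
  exists2 t, to_circle t = x & `|t| < e.
Proof.
move=> xe; have /(inf_adherent) : 0 < e - circle_norm x by rewrite subr_gt0.
move=> /(_ _ (has_inf_norms x))[_ [t tx <-]].
by rewrite addrC subrK => te; exists t.
Qed.

Lemma circle_norm0_eq0 x : circle_norm x = 0 -> x = 0.
Proof.
move=> x0; have [t tx t1] : exists2 t, to_circle t = x & `|t| < 2^-1.
  by apply: circle_norm_lift; rewrite x0 invr_gt0.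
have [t0|t0] := eqVneq t 0; first by rewrite -tx t0 to_circle0.
have [s sx st] : exists2 s, to_circle s = x & `|s| < `|t|.
  by apply: circle_norm_lift; rewrite x0 normr_gt0.
have /eqP := etrans sx (esym tx); rewrite to_circle_eq => /norm_intr_ge1.
rewrite subr_eq0 leNgt => /(_ _)/negP; case.
  by apply: contraTneq st => ->; rewrite ltxx.
rewrite (le_lt_trans (ler_normB _ _))// [ltRHS]splitr mul1r.
by rewrite ltrD// (lt_trans st).
Qed.

Definition circle_dist (x y : circle) : R := circle_norm (x - y).

Lemma circle_distxx x : circle_dist x x = 0.
Proof.
apply/eqP; rewrite eq_le /circle_dist subrr -to_circle0.
rewrite -[X in _ <= X](@normr0 _ R) circle_norm_le/=.
by apply: lb_le_inf; [case: (has_inf_norms (to_circle 0))|move=> _ [t _ <-]].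
Qed.

Lemma circle_dist_positivity x y : circle_dist x y = 0 -> x = y.
Proof. by move=> /circle_norm0_eq0/eqP; rewrite subr_eq0 => /eqP. Qed.

Lemma circle_dist_sym x y : circle_dist x y = circle_dist y x.
Proof.
have H (u v : circle) : circle_dist u v <= circle_dist v u.
  apply/ler_addgt0Pr => e e0.
  have [|t tx te] := @circle_norm_lift (v - u) (circle_dist v u + e).
    by rewrite ltrDl.
  by rewrite (le_trans _ (ltW te))// /circle_dist -opprB -tx -to_circleN -normrN
    circle_norm_le.
by apply/eqP; rewrite eq_le !H.
Qed.

Lemma circle_dist_triangle y x z :
  circle_dist x z <= circle_dist x y + circle_dist y z.
Proof.
apply/ler_addgt0Pr => e e0.
have [|s sx se] := @circle_norm_lift (x - y) (circle_dist x y + e / 2).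
  by rewrite ltrDl divr_gt0.
have [|t tx te] := @circle_norm_lift (y - z) (circle_dist y z + e / 2).
  by rewrite ltrDl divr_gt0.
rewrite [e in leRHS]splitr addrACA.
rewrite (le_trans _ (lerD (ltW se) (ltW te)))// (le_trans _ (ler_normD _ _))//.
by rewrite /circle_dist -(subrKA y) -sx -tx -to_circleD circle_norm_le.
Qed.

HB.instance Definition _ := isMetric.Build R circle
  circle_distxx circle_dist_positivity circle_dist_sym circle_dist_triangle.

Lemma to_circle_continuous : continuous to_circle.
Proof.
move=> t; apply/cvg_ballP => e e0; near=> s.
rewrite ballEmdist/=; apply: (@le_lt_trans _ _ `|t - s|).
  by rewrite /mdist/= /circle_dist -to_circleN -to_circleD circle_norm_le.
by near: s; exact: (@cvgr_dist_lt _ R^o).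
Unshelve. all: by end_near. Qed.

Lemma circle_compact : compact [set: circle].
Proof.
suff -> : [set: circle] = to_circle @` `[0, 1].
  apply: continuous_compact; last exact: segment_compact.
  exact/continuous_subspaceT/to_circle_continuous.
apply/esym; rewrite -subTset => x _; have [t <-] := to_circle_surj x.
exists (t - (Num.floor t)%:~R).
  rewrite /= in_itv/= subr_ge0 floor_le lerBlDr.
  by rewrite -[1]/(1%:~R) -intrD addrC ltW// floorD1_gt.
by apply/eqP; rewrite to_circle_eq addrAC subrr sub0r rpredN intr_int.
Qed.

End Circle.
Arguments circle R : clear implicits.

Section Hausdorff.
Context {R : realType} {T : metricType R}.
Implicit Types (A : set T) (U : (set T)^nat) (s delta : R).
Local Open Scope ereal_scope.

Definition diameter A : \bar R :=
  ereal_sup (0 |` [set (mdist p.1 p.2)%:E | p in A `*` A]).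

(* Empty pieces weigh nothing even when s = 0, whereas 0 `^ 0 = 1. *)
Definition hausdorff_weight s A : \bar R :=
  if `[< A = set0 >] then 0 else diameter A `^ s.

Definition delta_cover delta A U :=
  (forall i, diameter (U i) <= delta%:E) /\ A `<=` \bigcup_i U i.

Definition hausdorff_premeasure s delta A : \bar R :=
  ereal_inf [set \sum_(0 <= i <oo) hausdorff_weight s (U i) |
             U in delta_cover delta A].

Definition hausdorff_measure s A : \bar R :=
  ereal_sup [set hausdorff_premeasure s delta A |
             delta in [set delta | (0 < delta)%R]].

Definition hausdorff_dim A : \bar R :=
  ereal_inf [set s%:E | s in [set s | (0 <= s)%R /\ hausdorff_measure s A = 0]].

End Hausdorff.

Definition residual (X : topologicalType) (A : set X) :=
  exists U : (set X)^nat,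
    (forall n, open (U n) /\ dense (U n)) /\ \bigcap_n U n `<=` A.

Section ComplexMetric.
Context {R : realType}.
Implicit Types z w : Rcomplex R.

Definition complex_dist z w : R := `|w - z|.

Lemma complex_distxx z : complex_dist z z = 0.
Proof. by rewrite /complex_dist subrr normr0. Qed.

Lemma complex_dist_positivity z w : complex_dist z w = 0 -> z = w.
Proof. by move=> /normr0_eq0/eqP; rewrite subr_eq0 => /eqP. Qed.

Lemma complex_dist_sym z w : complex_dist z w = complex_dist w z.
Proof. exact: distrC. Qed.

Lemma complex_dist_triangle w z v :
  complex_dist z v <= complex_dist z w + complex_dist w v.
Proof. by rewrite addrC /complex_dist -(subrKA w) ler_normD. Qed.

HB.instance Definition _ := isPointed.Build (Rcomplex R) 0.
HB.instance Definition _ := isMetric.Build R (Rcomplex R) complex_distxx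
  complex_dist_positivity complex_dist_sym complex_dist_triangle.
HB.instance Definition _ := NormedZmoduleMetric.Build R (Rcomplex R)
  (fun=> fun=> erefl).

End ComplexMetric.

Variant scalar_field := RealScalars | ComplexScalars.

(* Rcomplex R is R[i] equipped with its R-valued modulus. *)
Definition scalars (R : realType) (k : scalar_field) :
    pseudoMetricNormedZmodType R :=
  match k with RealScalars => R^o | ComplexScalars => Rcomplex R end.

Definition circle_mean (R : realType) (g : circle R -> R) : R :=
  \int[lebesgue_measure]_(t in `[0, 1]) g (to_circle t).

Definition zero_mean (R : realType) (k : scalar_field) :
    (circle R -> scalars R k) -> Prop :=
  match k with
  | RealScalars => fun f => circle_mean f = 0
  | ComplexScalars => fun f =>
      circle_mean (fun x => complex.Re (f x)) = 0 /\
      circle_mean (fun x => complex.Im (f x)) = 0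
  end.

Section C0.
Context {R : realType} {k : scalar_field}.

Record C0 := mkC0 {
  C0_fun :> circle R -> scalars R k ;
  C0_continuous : continuous C0_fun ;
  C0_zero_mean : zero_mean C0_fun }.

HB.instance Definition _ := gen_eqMixin C0.
HB.instance Definition _ := gen_choiceMixin C0.

Implicit Types f g h : C0.

Definition sup_norm (u : circle R -> scalars R k) : R :=
  sup (range (fun x => `|u x|)).

Definition C0_dist f g : R := sup_norm (f \- g).

Lemma C0_has_sup f g : has_sup (range (fun x => `|(f \- g) x|)).
Proof.
split; first by exists `|(f \- g) 0|, 0.
have bounded (u : C0) : exists M : R, forall x, `|u x| <= M.
  have cu : continuous (fun x => `|u x| : R^o).
    move=> x; exact: (@cvg_norm _ _ _ _ (nbhs_filter x) _ _ (@C0_continuous u x)).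
  have /compact_bounded : compact ((fun x => `|u x| : R^o) @` [set: circle R]).
    apply: continuous_compact; last exact: circle_compact.
    exact: continuous_subspaceT.
  move=> [M [_ MP]]; exists (M + 1) => x.
  by rewrite -[leLHS]normr_id; apply: (MP (M + 1)); [rewrite ltrDl|exists x].
have [[M fM] [N gN]] := (bounded f, bounded g).
exists (M + N) => _ [x _ <-] /=.
by rewrite (le_trans (ler_normB _ _))// lerD.
Qed.

Lemma le_C0_dist f g x : `|f x - g x| <= C0_dist f g.
Proof. by apply: ub_le_sup; [case: (C0_has_sup f g)|exists x]. Qed.

Lemma C0_dist_le f g M : (forall x, `|f x - g x| <= M) -> C0_dist f g <= M.
Proof.
move=> fgM; apply: ge_sup => [|_ [x _ <-]]; last exact: fgM.
by case: (C0_has_sup f g).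
Qed.

Lemma C0_ext f g : f =1 g -> f = g.
Proof.
case: f g => [f cf mf] [g cg mg] /= /funext fg.
by move: cf mf; rewrite fg => cf mf; congr mkC0; exact: Prop_irrelevance.
Qed.

Lemma C0_distxx f : C0_dist f f = 0.
Proof.
apply/eqP; rewrite eq_le (le_trans _ (le_C0_dist f f 0))// andbT.
by apply: C0_dist_le => x; rewrite subrr normr0.
Qed.

Lemma C0_dist_positivity f g : C0_dist f g = 0 -> f = g.
Proof.
move=> fg0; apply: C0_ext => x; apply/eqP.
by rewrite -subr_eq0 -normr_le0 -fg0 le_C0_dist.
Qed.

Lemma C0_dist_sym f g : C0_dist f g = C0_dist g f.
Proof.
by apply/eqP; rewrite eq_le !C0_dist_le// => x; rewrite distrC le_C0_dist.
Qed.

Lemma C0_dist_triangle g f h : C0_dist f h <= C0_dist f g + C0_dist g h.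
Proof.
apply: C0_dist_le => x; rewrite -(subrKA (g x)).
by rewrite (le_trans (ler_normD _ _))// lerD// le_C0_dist.
Qed.

HB.instance Definition _ := isMetric.Build R C0
  C0_distxx C0_dist_positivity C0_dist_sym C0_dist_triangle.

End C0.
Arguments C0 R k : clear implicits.

Definition birkhoff_sum (R : realType) (k : scalar_field) (n : nat) (alpha : R)
    (f : circle R -> scalars R k) (x : circle R) : scalars R k :=
  \sum_(0 <= j < n) f (x + to_circle (j%:R * alpha)).

Definition slow_growth_set (R : realType) (k : scalar_field) (alpha : R)
    (psi : nat -> nat) (f : circle R -> scalars R k) : set (circle R) :=
  [set x | (limn_esup
    (fun n => (`|birkhoff_sum n alpha f x| / (psi n)%:R)%:E) < +oo)%E].

(* Main.v *)
(* Let [a] be the class of [alpha] and [S n f] the Birkhoff sums. Membership of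
   [x] in the slow growth set of [f] forces [|S n f x| <= m psi(n)] for all large
   [n] and [m]; so if, for each [m], some [n > m] makes the set of such [x]
   coverable by finitely many balls with [sum (diam ^ 2^-m) < 2^-m], a
   Borel-Cantelli argument gives dimension 0. Asking this with a margin is an
   open condition on [f].

   It is dense: since [S n f = o(n)] uniformly and [psi = o(n)], fix [n] with
   both much smaller than [e n], and add to [f] the coboundary
   [e (phi (x + a) - phi x)] where [|phi (x + a) - phi x| <= 1] everywhere and
   [|phi (x + n a) - phi x| = n] off a set with a cheap cover. For [phi] take
   (a continuous version of) the distance in time to a short arc. Along an orbit
   it is piecewise linear with slopes 1 and -1, and it turns only at visits of the
   arc and midway between two consecutive ones. By the three-gap theorem there are
   at most three return times, so the bad points lie in [O(n)] translates of the
   arc, whose length can be chosen after [n]. *)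

Require Import Defs.
From HB Require Import structures.
From mathcomp Require Import all_boot all_order all_algebra.
From mathcomp Require Import complex.
From mathcomp Require Import all_classical all_reals all_analysis.
From mathcomp Require Import zify lra.

Set Implicit Arguments.
Unset Strict Implicit.
Unset Printing Implicit Defensive.

Import Order.TTheory GRing.Theory Num.Theory.
Import numFieldNormedType.Exports.

Local Open Scope classical_set_scope.
Local Open Scope ring_scope.

(** * Returns of an irrational rotation *)

Section Rotation.
Context {R : realType}.

Lemma to_circleMn (t : R) n : to_circle (t *+ n) = to_circle t *+ n.
Proof.
by elim: n => [|n IH]; rewrite ?mulr0n ?to_circle0// !mulrS to_circleD IH.
Qed.

Lemma circle_norm_lt_lift (x : circle R) (w : R) :
  circle_norm x < w <-> exists2 t, to_circle t = x & `|t| < w.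
Proof.
split; first exact: circle_norm_lift.
by move=> [t <-]; apply: le_lt_trans; exact: circle_norm_le.
Qed.

Lemma irrational_aperiodic (alpha : R) : irrational alpha ->
  forall r, (0 < r)%N -> to_circle alpha *+ r != 0.
Proof.
move=> irr r r0; apply/negP => /eqP.
rewrite -to_circleMn -to_circle0 => /eqP.
rewrite to_circle_eq subr0 => /intrP[m mE]; apply: irr.
apply/rationalP; exists m, r.
by rewrite -mE -(mulr_natr alpha r) mulfK// pnatr_eq0 -lt0n.
Qed.

Lemma circle_lift_between (x : circle R) (b : R) :
  exists t, to_circle t = x /\ b <= t < b + 1.
Proof.
have [t <-] := to_circle_surj x.
exists (t - (Num.floor (t - b))%:~R); split.
  by apply/eqP; rewrite to_circle_eq addrAC subrr sub0r rpredN intr_int.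
have := floor_le (t - b); have := floorD1_gt (t - b).
by rewrite intrD /=; lra.
Qed.

Definition aperiodic (a : circle R) := forall r, (0 < r)%N -> a *+ r != 0.

(** By compactness the orbit of 0 has a cluster point; two visits near it, at times [m < n], give a
    return to 0 at time [n - m]. *)
Lemma close_return (a : circle R) (w : R) : 0 < w ->
  exists2 r, (0 < r)%N & circle_norm (a *+ r) < w.
Proof.
move=> w0.
have [c [_ cc]] := @circle_compact R ((fun n => a *+ n) @ \oo) _ filterT.
have visit N : exists2 n, (N < n)%N & circle_dist c (a *+ n) < w / 2.
  have [|//|_ [[n Nn <-] cn]] := cc [set a *+ n | n in [set n | (N < n)%N]]
      (ball c (w / 2)).
  - by exists N.+1 => // n Nn; exists n.
  - by apply: nbhsx_ballx; rewrite divr_gt0.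
  by exists n => //; move: cn; rewrite ballEmdist.
have [m _ cm] := visit 0%N; have [n mn cn] := visit m.
exists (n - m)%N; first by rewrite subn_gt0.
rewrite mulrnBr ?(ltnW mn)// [w]splitr.
rewrite (le_lt_trans (circle_dist_triangle c _ _))//.
by rewrite ltrD// circle_dist_sym.
Qed.

(** The last multiple of [t] not above 1 falls short of it by less than [t]. Modulo 1 this is a
    backward step shorter than [t]; aperiodicity will exclude 0. *)
Lemma small_overshoot (t : R) : 0 < t < 1 ->
  exists2 n, (0 < n)%N & -t < t *+ n - 1 <= 0.
Proof.
move=> /andP[t0 t1]; exists (Num.truncn t^-1).
  by rewrite truncn_gt0 invf_ge1// ltW.
have := @truncn_itv _ t^-1; rewrite invr_ge0 (ltW t0) => /(_ isT)/andP[].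
rewrite -(ler_pM2r t0) -(ltr_pM2r t0) mulVf ?gt_eqF// mulr_natl mulr_natl.
by rewrite mulrS; lra.
Qed.

Lemma opposite_step (a : circle R) (t : R) q : aperiodic a ->
  0 < t < 1 -> (0 < q)%N -> to_circle t = a *+ q ->
  exists2 n, (0 < n)%N & exists s, - t < s < 0 /\ to_circle s = a *+ n.
Proof.
move=> apa t01 q0 tq; have [n n0 /andP[ns sn]] := small_overshoot t01.
exists (q * n)%N; first by rewrite muln_gt0 q0.
have snE : to_circle (t *+ n - 1) = a *+ (q * n).
  rewrite mulrnA -tq -to_circleMn; apply/eqP; rewrite to_circle_eq.
  by rewrite addrAC subrr sub0r rpredN rpred1.
exists (t *+ n - 1); split => //; rewrite ns lt_neqAle sn andbT.
apply/eqP => s0; move: (apa (q * n)%N); rewrite -snE s0 to_circle0 eqxx.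
by rewrite muln_gt0 q0 n0 => /(_ isT).
Qed.

Lemma aperiodicN (a : circle R) : aperiodic a -> aperiodic (- a).
Proof. by move=> apa r r0; rewrite mulNrn oppr_eq0 apa. Qed.

Lemma two_steps (a : circle R) (w : R) : aperiodic a -> 0 < w ->
  (exists2 n, (0 < n)%N & exists t, 0 < t < w /\ to_circle t = a *+ n) /\
  (exists2 n, (0 < n)%N & exists t, - w < t < 0 /\ to_circle t = a *+ n).
Proof.
move=> apa w0.
have [] := @close_return a (Num.min w 1); first by rewrite lt_min w0 ltr01.
move=> r r0 /circle_norm_lt_lift[t tr]; rewrite lt_min => /andP[tw t1].
have t0 : t != 0 by apply: contra_neq (apa _ r0) => t0; rewrite -tr t0 to_circle0.
move: t0; rewrite neq_lt => /orP[t0|t0].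
  have [] := @opposite_step (- a) (- t) r (aperiodicN apa) _ r0.
  - by move: t1; rewrite ltr0_norm// => ->; rewrite oppr_gt0 t0.
  - by rewrite to_circleN tr mulNrn.
  move=> n n0 [s [sn sE]]; move: tw; rewrite ltr0_norm// => tw.
  split; last by exists r => //; exists t; split=> //; lra.
  exists n => //; exists (- s); split; first by lra.
  by rewrite to_circleN sE mulNrn opprK.
move: tw t1; rewrite gtr0_norm// => tw t1.
split; first by exists r => //; exists t; rewrite t0.
have [|n n0 [s [sn sE]]] := @opposite_step a t r apa _ r0 tr; first by rewrite t0.
by exists n => //; exists s; split=> //; lra.
Qed.

(** Lift [x] to [-1, 0) and advance by a step [t] in (0, w), realised by [q] rotations, as long as 0
    is not passed; this takes at most 1/t steps, whatever [x]. *)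
Lemma uniform_hit (a : circle R) (w : R) : aperiodic a -> 0 < w ->
  exists L, forall x, exists2 j, (j <= L)%N & circle_norm (x + a *+ j) < w.
Proof.
move=> apa w0; have [[q q0 [t [/andP[t0 tw] tq]]] _] := two_steps apa w0.
exists (q * Num.truncn t^-1)%N => x.
have [s [<- s1]] := circle_lift_between x (-1).
have s0 : s <= 0 by lra.
exists (q * Num.truncn (- s / t))%N.
  by rewrite leq_mul2l le_truncn ?orbT// ler_pdivrMr// mulVf ?gt_eqF//; lra.
rewrite circle_norm_lt_lift; exists (s + t *+ Num.truncn (- s / t)).
  by rewrite to_circleD to_circleMn tq mulrnA.
have := @truncn_itv _ (- s / t).
rewrite divr_ge0 ?(ltW t0) ?oppr_ge0 ?s0//.
move=> /(_ isT)/andP[]; rewrite ler_pdivlMr// ltr_pdivrMr// !mulr_natl mulrS.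
by rewrite ltr_norml; lra.
Qed.

(* With [q], [p] the least times at which the orbit of 0 enters (0, 2w) and
   (-2w, 0), the three-gap theorem: an interval of length [2w] has return times
   among [q], [p] and [q + p]. *)
Lemma three_gap (a : circle R) (w : R) : aperiodic a -> 0 < w ->
  exists q p, forall (y : circle R) r, (0 < r)%N ->
    circle_norm y < w -> circle_norm (y + a *+ r) < w ->
    (forall i, (0 < i < r)%N -> w <= circle_norm (y + a *+ i)) ->
    r = q \/ r = p \/ r = (q + p)%N.
Proof.
move=> apa w0; have w20 : 0 < w *+ 2 by rewrite pmulrn_rgt0.
have [[q0 q00 q01] [p0 p00 p01]] := two_steps apa w20.
have exq : exists n, `[< (0 < n)%N /\
    exists t, 0 < t < w *+ 2 /\ to_circle t = a *+ n >].
  by exists q0; apply/asboolP.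
have exp : exists n, `[< (0 < n)%N /\
    exists t, - (w *+ 2) < t < 0 /\ to_circle t = a *+ n >].
  by exists p0; apply/asboolP.
case: (ex_minnP exq) => q /asboolP[{}q00 [u [u0 uq]]] qmin.
case: (ex_minnP exp) => p /asboolP[{}p00 [v [v0 vp]]] pmin.
exists q, p => y r r0 /circle_norm_lt_lift[s sy sw].
move=> /circle_norm_lt_lift[s' sy' sw'] first.
have notin z i : (0 < i < r)%N -> to_circle z = y + a *+ i -> ~ `|z| < w.
  move=> /first wi zi zw; move: wi; apply/negP; rewrite -ltNge.
  by apply/circle_norm_lt_lift; exists z.
have tr : to_circle (s' - s) = a *+ r.
  by rewrite to_circleD to_circleN sy sy' addrAC subrr add0r.
move: sw sw'; rewrite !ltr_norml => sw sw'.
(* If neither adding [u] nor adding [v] keeps the lift [s] in (-w, w), then adding both does, so a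
   return occurs by time [q + p]. *)
have rqp : (r <= q + p)%N.
  rewrite leqNgt; apply/negP => qpr.
  have [su|us] := ltP (s + u) w.
    apply: (@notin (s + u) q).
      by rewrite q00 (leq_ltn_trans _ qpr) ?leq_addr.
      by rewrite to_circleD sy uq.
    by rewrite ltr_norml; lra.
  have [sv|vs] := ltP (- w) (s + v).
    apply: (@notin (s + v) p).
      by rewrite p00 (leq_ltn_trans _ qpr) ?leq_addl.
      by rewrite to_circleD sy vp.
    by rewrite ltr_norml; lra.
  apply: (@notin (s + u + v) (q + p)%N).
    by rewrite addn_gt0 q00 qpr.
    by rewrite !to_circleD sy vp uq mulrnDr addrA.
  by rewrite ltr_norml; lra.
have t0 : s' - s != 0.
  by apply: contra_neq (apa _ r0) => t0; rewrite -tr t0 to_circle0.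
have nz i z : (i < r)%N -> to_circle z = a *+ (r - i) -> z != 0.
  move=> ir zE; have ri : (0 < r - i)%N by rewrite subn_gt0.
  by apply: contra_neq (apa _ ri) => z0; rewrite -zE z0 to_circle0.
(* The sign of [s' - s] decides which of [p] and [q] bounds [r] from below. Once that step is
   removed, the remaining displacement either keeps its sign and exhibits an earlier visit, or
   changes sign, and minimality of the other step gives [r >= q + p]. *)
move: t0; rewrite neq_lt => /orP[t0|t0].
  have : (p <= r)%N.
    by apply: pmin; apply/asboolP; split=> //; exists (s' - s); split=> //; lra.
  rewrite leq_eqVlt => /orP[/eqP->|pr]; first by right; left.
  have tvE : to_circle (s' - s - v) = a *+ (r - p).
    by rewrite to_circleD tr to_circleN vp mulrnBr// ltnW.
  have := nz p _ pr tvE; rewrite neq_lt => /orP[tv|tv].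
    exfalso; apply: (@notin (s' - v) (r - p)%N).
      by rewrite subn_gt0 pr ltn_subrL p00 r0.
      by rewrite -tvE -sy -to_circleD; congr to_circle; lra.
    by rewrite ltr_norml; lra.
  have : (q <= r - p)%N.
    apply: qmin; apply/asboolP; split; first by rewrite subn_gt0.
    by exists (s' - s - v); split=> //; lra.
  rewrite leq_subRL ?(ltnW pr)// addnC => qpr.
  by right; right; apply/eqP; rewrite eqn_leq rqp.
have : (q <= r)%N.
  by apply: qmin; apply/asboolP; split=> //; exists (s' - s); split=> //; lra.
rewrite leq_eqVlt => /orP[/eqP->|qr]; first by left.
have tuE : to_circle (s' - s - u) = a *+ (r - q).
  by rewrite to_circleD tr to_circleN uq mulrnBr// ltnW.
have := nz q _ qr tuE; rewrite neq_lt => /orP[tu|tu].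
  have : (p <= r - q)%N.
    apply: pmin; apply/asboolP; split; first by rewrite subn_gt0.
    by exists (s' - s - u); split=> //; lra.
  rewrite leq_subRL ?(ltnW qr)// => qpr.
  by right; right; apply/eqP; rewrite eqn_leq rqp.
exfalso; apply: (@notin (s' - u) (r - q)%N).
    by rewrite subn_gt0 qr ltn_subrL q00 r0.
  by rewrite -tuE -sy -to_circleD; congr to_circle; lra.
by rewrite ltr_norml; lra.
Qed.

End Rotation.

(** * Distance in time to an arc *)

Section OrbitInf.
Context {R : realType}.

Lemma circle_norm_ge0 (x : circle R) : 0 <= circle_norm x.
Proof.
rewrite leNgt; apply/negP => /circle_norm_lift[t _].
by rewrite ltNge normr_ge0.
Qed.

Lemma circle_norm_lip (x y : circle R) :
  `|circle_norm x - circle_norm y| <= circle_dist x y.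
Proof.
have le (u v : circle R) : circle_norm u - circle_norm v <= circle_dist u v.
  rewrite lerBlDr.
  by have := circle_dist_triangle v u 0; rewrite /circle_dist !subr0.
by rewrite ler_norml lerNl opprB le circle_dist_sym le.
Qed.

Lemma circle_dist_addr (x y z : circle R) :
  circle_dist (x + z) (y + z) = circle_dist x y.
Proof. by rewrite /circle_dist opprD addrACA subrr addr0. Qed.

Lemma max0_lip (u v : R) : `|Num.max 0 u - Num.max 0 v| <= `|u - v|.
Proof.
rewrite !maxEle; do 2 case: ifPn => ?; rewrite ler_norml.
all: by case: (ler0P (u - v)); lra.
Qed.

Variables (a : circle R) (rho : circle R -> R).
Hypothesis rho_ge0 : forall x, 0 <= rho x.

Let cost x (k : int) := `|k|%N%:R + rho (x + a *~ k).

(** An inf-convolution along the orbit. For a Lipschitz [rho], zero on an arc and large away from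
    it, this is a Lipschitz version of the distance in time to the arc. *)
Definition orbit_inf x := inf [set cost x k | k in [set: int]].

Lemma orbit_inf_le x k : orbit_inf x <= `|k|%N%:R + rho (x + a *~ k).
Proof.
apply: ge_inf; last by exists k.
by exists 0 => _ [j _ <-]; rewrite addr_ge0.
Qed.

Lemma le_orbit_inf x c : (forall k : int, c <= `|k|%N%:R + rho (x + a *~ k)) ->
  c <= orbit_inf x.
Proof.
move=> cx; apply: lb_le_inf; first by exists (cost x 0), 0.
by move=> _ [k _ <-]; exact: cx.
Qed.

(** Reindexing [k] by one matches the orbits of [x] and [x + a] and changes [|k|] by at most 1. *)
Lemma orbit_inf_step x : `|orbit_inf (x + a) - orbit_inf x| <= 1.
Proof.
have up : orbit_inf (x + a) - 1 <= orbit_inf x.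
  apply: le_orbit_inf => k.
  rewrite lerBlDr (le_trans (orbit_inf_le _ (k - 1)))//.
  have -> : x + a + a *~ (k - 1) = x + a *~ k.
    by rewrite mulrzBr mulr1z -addrA (addrC a) subrK.
  by rewrite [leRHS]addrAC lerD2r natr1 ler_nat; lia.
have dn : orbit_inf x - 1 <= orbit_inf (x + a).
  apply: le_orbit_inf => k.
  rewrite lerBlDr (le_trans (orbit_inf_le _ (k + 1)))//.
  have -> : x + a *~ (k + 1) = x + a + a *~ k.
    by rewrite mulrzDr mulr1z -addrA (addrC a).
  by rewrite [leRHS]addrAC lerD2r natr1 ler_nat; lia.
by rewrite ler_norml; lra.
Qed.

(** Rotations are isometries, so every competitor in the infimum inherits the constant of [rho]. *)
Lemma orbit_inf_lip C x y : (forall x y, `|rho x - rho y| <= C * circle_dist x y) ->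
  `|orbit_inf x - orbit_inf y| <= C * circle_dist x y.
Proof.
move=> lip.
have le u v : orbit_inf u - C * circle_dist u v <= orbit_inf v.
  apply: le_orbit_inf => k; have := orbit_inf_le u k.
  have := lip (u + a *~ k) (v + a *~ k); rewrite circle_dist_addr ler_norml.
  by lra.
by have := le x y; have := le y x; rewrite (circle_dist_sym y) ler_norml; lra.
Qed.

(** The visits at times [-b] and [c] give the upper bound. For the lower one, times with
    [|k| >= minn b c] cost enough by [|k|] alone, and the others lie strictly between the visits,
    where [rho] is at least [K]. *)
Lemma orbit_infE x (b c K : nat) : (minn b c <= K)%N ->
  rho (x + a *~ (- b%:Z)) = 0 -> rho (x + a *~ c%:Z) = 0 ->
  (forall k : int, - b%:Z < k < c%:Z -> (`|k| <= K)%N ->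
     K%:R <= rho (x + a *~ k)) ->
  orbit_inf x = (minn b c)%:R.
Proof.
move=> bcK rb rc rK; apply/eqP; rewrite eq_le; apply/andP; split.
  have := orbit_inf_le x (- b%:Z); have := orbit_inf_le x c%:Z.
  rewrite rb rc !addr0 abszN !absz_nat natr_min.
  by rewrite le_min => -> ->.
apply: le_orbit_inf => k.
have [mk|km] := leqP (minn b c) `|k|.
  by rewrite -[leLHS]addr0 lerD// ler_nat.
rewrite -[leLHS]add0r lerD// (le_trans _ (rK k _ _))// ?ler_nat//; lia.
Qed.

End OrbitInf.

Section Tower.
Context {R : realType}.

(** Lets a radius be chosen after the number [N] of arcs in a cover: [w] solves (2w)^e = c/(N+1),
    and [N < N+1] makes the bound strict. *)
Lemma small_powR (N : nat) (e c : R) : 0 < e -> 0 < c ->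
  exists2 w : R, 0 < w & N%:R * (w *+ 2) `^ e < c.
Proof.
move=> e0 c0; have cN0 : 0 < c / N.+1%:R by rewrite divr_gt0.
exists ((c / N.+1%:R) `^ e^-1 / 2); first by rewrite divr_gt0// powR_gt0.
rewrite -[X in X `^ _]mulr_natr divfK// -powRrM mulVf ?gt_eqF// powRr1 ?(ltW cN0)//.
by rewrite mulrCA gtr_pMr// ltr_pdivrMr// mul1r ltr_nat.
Qed.

(** A lift [t] with [w <= |t| < w + d] is within [d] of [w] or of [-w], so two arcs of radius [d]
    catch the whole layer around the arc. *)
Lemma off_layer (x : circle R) (w d : R) :
  d <= circle_dist (to_circle w) x -> d <= circle_dist (to_circle (- w)) x ->
  circle_norm x < w + d -> circle_norm x < w.
Proof.
move=> dw dNw /circle_norm_lift[t tx td].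
rewrite ltNge; apply/negP => wx.
have wt : w <= `|t| by rewrite (le_trans wx)// -tx circle_norm_le.
have near v : d <= circle_dist (to_circle v) x -> d <= `|v - t|.
  move=> /le_trans; apply.
  by rewrite -tx /circle_dist -to_circleN -to_circleD circle_norm_le.
move: (near _ dw) (near _ dNw) td wt.
rewrite real_leNgt ?num_real// real_leNgt ?num_real//.
rewrite !ltr_norml !real_ler_normr ?num_real// => /negP h1 /negP h2 h3.
by case/orP => h4; [apply: h1|apply: h2]; lra.
Qed.

End Tower.

(** * Last and next visits to the arc *)

Section Visits.
Context {R : realType}.
Variables (a : circle R) (w : R).

(** The present counts as past: [b] may be 0 while [c] is positive, so [b + c] is a true return time
    of the arc. *)
Definition last_next_visit (x : circle R) (b c : nat) :=
  [/\ (0 < c)%N, circle_norm (x + a *~ - b%:Z) < w, circle_norm (x + a *~ c) < w &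
      forall k : int, - b%:Z < k < c%:Z -> w <= circle_norm (x + a *~ k)].

(** A hit searched from [L] steps in the past yields [b]; one searched from one step ahead yields
    [c], hence the bound [L.+1]. *)
Lemma last_next_visitP L :
  (forall x, exists2 j, (j <= L)%N & circle_norm (x + a *+ j) < w) ->
  forall x, exists b c, [/\ (b <= L)%N, (c <= L.+1)%N & last_next_visit x b c].
Proof.
move=> hit x.
have exb : exists b, circle_norm (x + a *~ - b%:Z) < w.
  have [j jL xj] := hit (x - a *+ L); exists (L - j)%N.
  by move: xj; rewrite mulrNz -pmulrn mulrnBr// opprB [a *+ j - _]addrC addrA.
have exc : exists c, (0 < c)%N && (circle_norm (x + a *~ c) < w).
  have [j jL xj] := hit (x + a); exists j.+1.
  by rewrite -pmulrn mulrS addrA.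
case: (ex_minnP exb) => b bw bmin; case: (ex_minnP exc) => c /andP[c0 cw] cmin.
exists b, c; split.
- have [j jL xj] := hit (x - a *+ L); apply: leq_trans (leq_subr j L).
  apply: bmin.
  by move: xj; rewrite mulrNz -pmulrn mulrnBr// opprB [a *+ j - _]addrC addrA.
- have [j jL xj] := hit (x + a); apply: (@leq_trans j.+1); last by [].
  by apply: cmin; rewrite -pmulrn mulrS addrA.
split=> // -[[|k]|k] /andP[bk kc]; rewrite leNgt; apply/negP => xw.
- have := bmin 0%N; rewrite oppr0 => /(_ xw); rewrite leqn0 => /eqP b0.
  by move: bk; rewrite b0.
- have := cmin k.+1; rewrite xw => /(_ isT).
  by rewrite leqNgt => /negP; apply; lia.
- have := bmin k.+1; rewrite -NegzE xw => /(_ isT).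
  by rewrite leqNgt => /negP; apply; lia.
Qed.

Lemma return_time_visit q p :
  (forall (y : circle R) r, (0 < r)%N ->
    circle_norm y < w -> circle_norm (y + a *+ r) < w ->
    (forall i, (0 < i < r)%N -> w <= circle_norm (y + a *+ i)) ->
    r = q \/ r = p \/ r = (q + p)%N) ->
  forall x b c, last_next_visit x b c -> (b + c)%N \in [:: q; p; (q + p)%N].
Proof.
move=> ret x b c [c0 xb xc xbc].
have shift j : x + a *~ - b%:Z + a *+ j = x + a *~ (j%:Z - b%:Z).
  by rewrite mulrzBr mulrNz -addrA [- _ + _]addrC -pmulrn.
have [|//||||] := ret (x + a *~ - b%:Z) (b + c)%N.
- by rewrite addn_gt0 c0 orbT.
- by rewrite shift PoszD addrAC subrr add0r.
- by move=> i ibc; rewrite shift; apply: xbc; lia.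
- by move=> ->; rewrite !inE eqxx.
- by case=> ->; rewrite !inE eqxx ?orbT.
Qed.

(** As time passes, [minn b c] rises by 1 per step up to the midpoint, where [c] is half of
    [r = b + c], then falls until [c = 0]. It can turn within [n] steps only if [c] is in [0, n] or
    in [r/2, r/2 + n], and [r] takes at most three values. *)
Lemma hitting_time_increment (q p n b c : nat) :
  (b + c)%N \in [:: q; p; (q + p)%N] ->
  c \notin iota 0 n.+1 ++ flatten [seq iota r./2 n.+1 | r <- [:: q; p; (q + p)%N]] ->
  (n < c)%N /\
  ((minn (b + n) (c - n) = minn b c + n) \/ (minn (b + n) (c - n) + n = minn b c))%N.
Proof.
move=> bc; rewrite mem_cat negb_or mem_iota add0n ltnS -ltnNge => /andP[nc ncs].
have : c \notin iota (b + c)./2 n.+1.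
  by apply: contra ncs => cbc; apply/flatten_mapP; exists (b + c)%N.
by rewrite mem_iota {bc ncs}; split=> //; lia.
Qed.

End Visits.

(** * The function with large increments over [n] steps *)

Section Tower.
Context {R : realType}.
Variable a : circle R.

Let visit := @last_next_visit R a.

(** Off the layer, an orbit point at a time up to [K] is either in the arc, where [rho] is 0, or
    past the layer, where [rho] is at least [K]; this is what [orbit_infE] asks for. *)
Lemma orbit_inf_off_layer (w d : R) (K b c : nat) (x : circle R) : 0 < d ->
  let rho y := K%:R * Num.max 0 ((circle_norm y - w) / d) in
  (minn b c <= K)%N -> visit w x b c ->
  (forall k : int, (`|k| <= K)%N ->
     circle_norm (x + a *~ k) < w + d -> circle_norm (x + a *~ k) < w) ->
  orbit_inf a rho x = (minn b c)%:R.
Proof.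
move=> d0 rho bcK [c0 xb xc xbc] off.
have rho0 y : circle_norm y < w -> rho y = 0.
  move=> yw; rewrite /rho max_l ?mulr0// pmulr_lle0 ?invr_gt0//.
  by rewrite subr_le0 ltW.
apply: (@orbit_infE _ _ _ _ _ _ _ K) => //; try exact: rho0.
  by move=> y; rewrite mulr_ge0// le_max lexx.
move=> k kbc kK; rewrite /rho ler_peMr// le_max; apply/orP; right.
rewrite ler_pdivlMr// mul1r lerBrDl leNgt; apply/negP => /(off k kK).
by rewrite ltNge xbc.
Qed.

Lemma int_shift (k : int) (N : nat) : (`|k| <= N)%N ->
  exists2 j, j \in iota 0 N.*2.+1 & j%:Z = k + N%:Z.
Proof. by move=> kN; exists (absz (k + N%:Z)); rewrite ?mem_iota; lia. Qed.

Lemma visitS (w : R) (x : circle R) (b c n : nat) : (n < c)%N ->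
  visit w x b c -> visit w (x + a *+ n) (b + n) (c - n).
Proof.
move=> nc [c0 xb xc xbc].
have shift (k : int) : x + a *+ n + a *~ k = x + a *~ (k + n%:Z).
  by rewrite mulrzDr -pmulrn -addrA [a *+ n + _]addrC.
split; first by rewrite subn_gt0.
- by rewrite shift PoszD opprD subrK.
- by rewrite shift -subzn ?(ltnW nc)// subrK.
- by move=> k kbc; rewrite shift; apply: xbc; lia.
Qed.

(* The witness is [inf_k |k| + rho (x + k a)] with [rho] zero on the arc of radius
   [w] and rising steeply around it; the list [s] consists of the translates of
   the arc described above and of the layers where [rho] rises. *)
Lemma tower_function (n : nat) (e c : R) : aperiodic a -> 0 < e -> 0 < c ->
  exists (phi : circle R -> R) (C : R) (s : seq (circle R * R)),
  [/\ forall x y, `|phi x - phi y| <= C * circle_dist x y,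
      forall x, `|phi (x + a) - phi x| <= 1,
      forall p, p \in s -> 0 < p.2,
      \sum_(p <- s) (p.2 *+ 2) `^ e < c &
      forall x, (forall p, p \in s -> p.2 <= circle_dist p.1 x) ->
        `|phi (x + a *+ n) - phi x| = n%:R].
Proof.
move=> apa e0 c0; have c20 : 0 < c / 2 by rewrite divr_gt0.
(* [4 * n.+1] is the length of [cs] below: four windows of [n.+1] times. The translates of the arc
   get half of the cost [c], the layers the other half. *)
have [w w0 wN] := small_powR (4 * n.+1) e0 c20.
have [L hit] := uniform_hit apa w0.
have [q [p gap]] := three_gap apa w0.
(* [K] bounds the distance in time to the arc; [N] makes room for times up to [K] counted from
   [x + a *+ n]. Then [2 * N.*2.+1] counts two edges times the shifts from [-N] to [N]. *)
pose K := L.+1; pose N := (K + n)%N.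
have [d d0 dN] := small_powR (2 * N.*2.+1) e0 c20.
pose rho y := K%:R * Num.max 0 ((circle_norm y - w) / d).
have rho0 y : 0 <= rho y by rewrite mulr_ge0// le_max lexx.
pose cs := iota 0 n.+1 ++ flatten [seq iota r./2 n.+1 | r <- [:: q; p; (q + p)%N]].
(* A point within [w] of [- (a *+ i)] visits the arc at time [i]; a point near the centre of index
   [j] in [layer v] is near [v] at time [j - N]. *)
pose s1 := [seq (- (a *+ i), w) | i <- cs].
pose layer v := [seq (to_circle v + a *+ N - a *+ j, d) | j <- iota 0 N.*2.+1].
exists (orbit_inf a rho), (K%:R / d), (s1 ++ (layer w ++ layer (- w))); split.
- move=> x y; apply: orbit_inf_lip => // {}x {}y; rewrite /rho -mulrBr.
  rewrite normrM ger0_norm// -mulrA; apply: ler_wpM2l => //.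
  rewrite (le_trans (max0_lip _ _))// -mulrBl normrM mulrC.
  rewrite gtr0_norm ?invr_gt0//; apply: ler_wpM2l; first by rewrite invr_ge0 ltW.
  by rewrite opprB addrA subrK circle_norm_lip.
- by move=> x; exact: orbit_inf_step.
- by move=> u; rewrite !mem_cat => /or3P[] /mapP[i _ ->].
- have sum v (f : nat -> circle R) l :
      \sum_(u <- [seq (f i, v) | i <- l]) (u.2 *+ 2) `^ e =
      (v *+ 2) `^ e *+ size l.
    by rewrite big_map /= big_const_seq count_predT iter_addr addr0.
  rewrite !big_cat /= !sum !size_iota -mulrnDr addnn -mul2n.
  have -> : size cs = (4 * n.+1)%N.
    by rewrite /cs size_cat size_flatten size_iota /= !size_iota; lia.
  by rewrite [c]splitr -[_ *+ (4 * _)]mulr_natl -[_ *+ (2 * _)]mulr_natl ltrD.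
move=> x off.
have [b [t [bL tL xbt]]] := last_next_visitP hit x.
have tcs : t \notin cs.
  apply/negP => tcs; have : (- (a *+ t), w) \in s1 by apply/mapP; exists t.
  move=> sx; have /off/= : (- (a *+ t), w) \in s1 ++ (layer w ++ layer (- w)).
    by rewrite mem_cat sx.
  rewrite circle_dist_sym /circle_dist opprK leNgt => /negP; apply.
  by case: xbt.
have [nt inc] := hitting_time_increment (return_time_visit gap xbt) tcs.
have offl (k : int) : (`|k| <= N)%N ->
    circle_norm (x + a *~ k) < w + d -> circle_norm (x + a *~ k) < w.
  move=> kN.
  have [j jN jkE] := int_shift kN.
  have dist v : circle_dist (to_circle v + a *+ N - a *+ j) x =
      circle_dist (to_circle v) (x + a *~ k).
    have -> : k = j%:Z - N%:Z by rewrite jkE addrK.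
    rewrite /circle_dist mulrzBr -!pmulrn; congr circle_norm.
    by rewrite opprD opprB -!addrA; congr (_ + _); rewrite addrA addrC.
  apply: off_layer; rewrite -dist.
    by apply: (off (_, d)); rewrite !mem_cat map_f ?orbT.
  by apply: (off (_, d)); rewrite !mem_cat map_f ?orbT.
have -> : orbit_inf a rho x = (minn b t)%:R.
  apply: orbit_inf_off_layer => //; first by rewrite geq_min (leqW bL).
  by move=> k kK; apply: offl; rewrite (leq_trans kK)// leq_addr.
have -> : orbit_inf a rho (x + a *+ n) = (minn (b + n) (t - n))%:R.
  apply: orbit_inf_off_layer => //.
  - by rewrite geq_min (leq_trans (leq_subr _ _) tL) orbT.
  - exact: visitS.
  move=> k kK; have -> : x + a *+ n + a *~ k = x + a *~ (k + n%:Z).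
    by rewrite mulrzDr -pmulrn -addrA [a *+ n + _]addrC.
  by apply: offl; rewrite /N; lia.
case: inc => [->|<-].
  by rewrite natrD addrAC subrr add0r ger0_norm.
by rewrite natrD opprD addrA subrr add0r normrN ger0_norm.
Qed.

End Tower.

(** * Means over the circle *)

Section Mean.
Context {R : realType}.
Notation mu := (@lebesgue_measure R).

Section ContinuousIntegral.
Variable G : R -> R^o.
Hypothesis cG : continuous G.

Lemma continuous_segment_integrable (u v : R) :
  mu.-integrable `[u, v] (EFin \o G).
Proof.
apply: continuous_compact_integrable; first exact: segment_compact.
exact: continuous_subspaceT.
Qed.

Lemma Rintegral_segmentB (u x v : R) : u <= x -> x <= v ->
  \int[mu]_(t in `[u, v]) G t - \int[mu]_(t in `[u, x]) G t =
  \int[mu]_(t in `[x, v]) G t.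
Proof.
move=> ux xv; rewrite Rintegral_itvB ?bnd_simp//.
  rewrite Rintegral_itv_obnd_cbnd//.
  apply: integrableS (continuous_segment_integrable x v) => //.
  exact: subset_itv_oc_cc.
exact: continuous_segment_integrable.
Qed.

Lemma Rintegral_segment_shift (u v c : R) : u <= v ->
  \int[mu]_(t in `[u + c, v + c]) G t = \int[mu]_(t in `[u, v]) G (t + c).
Proof.
move=> uv; rewrite /Rintegral.
have dF (x : R) : is_derive x 1 (fun t : R => t + c) 1.
  by rewrite -[X in is_derive _ _ _ X]addr0; apply: is_deriveD.
have F'E : derive1 (fun t : R => t + c) = cst 1.
  by apply/funext => x; rewrite derive1E; apply: derive_val.
have cF (x : R) : {for x, continuous (fun t : R => t + c)}.
  by apply: cvgD; [exact: cvg_id|exact: cvg_cst].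
rewrite (@integration_by_substitution_increasing _ (fun t => t + c) G)//.
- by congr fine; apply: eq_integral => x _ /=; rewrite F'E /= mulr1.
- by move=> x y _ _ xy; rewrite ltrD2r.
- by move=> x _; rewrite F'E; exact: cvg_cst.
- by rewrite F'E; exact: is_cvg_cst.
- by rewrite F'E; exact: is_cvg_cst.
- split.
  + by move=> x _; have [] := dF x.
  + by apply: cvg_at_right_filter; exact: cF.
  + by apply: cvg_at_left_filter; exact: cF.
- exact: continuous_subspaceT.
Qed.

(** Passing from [0, 1] to [c, 1 + c] adds the integral over [1, 1 + c] and removes that over
    [0, c]; periodicity makes the two equal. *)
Lemma Rintegral_periodic_shift (c : R) : (forall t, G (t + 1) = G t) ->
  0 <= c -> \int[mu]_(t in `[0, 1]) G (t + c) = \int[mu]_(t in `[0, 1]) G t.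
Proof.
move=> per c0; rewrite -Rintegral_segment_shift ?ler01// add0r.
have c1 : c <= 1 + c by rewrite lerDr.
rewrite -(Rintegral_segmentB c0 c1).
have c2 : 1 <= 1 + c by rewrite lerDl.
have /eqP := Rintegral_segmentB (@ler01 R) c2.
rewrite subr_eq => /eqP ->; rewrite -[X in `[X, _]]add0r [1 + c]addrC.
rewrite Rintegral_segment_shift//.
under eq_Rintegral do rewrite per.
by rewrite addrAC subrr add0r.
Qed.

End ContinuousIntegral.

Lemma continuous_lift (g : circle R -> R) : continuous (g : circle R -> R^o) ->
  continuous (fun t : R => g (to_circle t) : R^o).
Proof.
move=> cg t.
by apply: continuous_comp; [exact: to_circle_continuous|exact: cg].
Qed.

Lemma circle_mean_rotation (g : circle R -> R) (c : circle R) :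
  continuous (g : circle R -> R^o) ->
  circle_mean (fun x => g (x + c)) = circle_mean g.
Proof.
move=> cg; have [s [<- s0]] := circle_lift_between c 0.
rewrite /circle_mean; under eq_Rintegral do rewrite -to_circleD.
rewrite (@Rintegral_periodic_shift (fun t => g (to_circle t)))//.
- exact: continuous_lift.
- move=> t; congr g; apply/eqP; rewrite to_circle_eq.
  by rewrite addrAC subrr add0r rpred1.
- by case/andP: s0.
Qed.

Lemma circle_integrable (g : circle R -> R) : continuous (g : circle R -> R^o) ->
  mu.-integrable `[0, 1] (EFin \o (fun t => g (to_circle t))).
Proof. move=> cg; exact: (continuous_segment_integrable (continuous_lift cg)). Qed.

Lemma circle_meanD (g h : circle R -> R) :
  continuous (g : circle R -> R^o) -> continuous (h : circle R -> R^o) ->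
  circle_mean (fun x => g x + h x) = circle_mean g + circle_mean h.
Proof. by move=> cg ch; apply: RintegralD => //; exact: circle_integrable. Qed.

Lemma circle_meanB (g h : circle R -> R) : continuous (g : circle R -> R^o) ->
  continuous (h : circle R -> R^o) ->
  circle_mean (fun x => g x - h x) = circle_mean g - circle_mean h.
Proof. by move=> cg ch; apply: RintegralB => //; exact: circle_integrable. Qed.

Lemma circle_meanZ (r : R) (g : circle R -> R) : continuous (g : circle R -> R^o) ->
  circle_mean (fun x => r * g x) = r * circle_mean g.
Proof. by move=> cg; apply: RintegralZl => //; exact: circle_integrable. Qed.

Lemma circle_mean_cst (r : R) : circle_mean (fun _ : circle R => r) = r.
Proof.
have := @lebesgue_measure_itv R `[0, 1].
rewrite /circle_mean Rintegral_cst//= => ->.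
by rewrite lte_fin ltr01 -EFinD/= subr0 mulr1.
Qed.

Lemma le_circle_mean (g h : circle R -> R) :
  continuous (g : circle R -> R^o) -> continuous (h : circle R -> R^o) ->
  (forall x, g x <= h x) -> circle_mean g <= circle_mean h.
Proof.
by move=> cg ch gh; apply: le_Rintegral => //; exact: circle_integrable.
Qed.

(** The mean 0 lies between the constants [g x - e] and [g x + e], which bound [g]. *)
Lemma zero_mean_le_osc (g : circle R -> R) (e : R) : continuous (g : circle R -> R^o) ->
  circle_mean g = 0 -> (forall x y, `|g x - g y| <= e) -> forall x, `|g x| <= e.
Proof.
move=> cg g0 osc x; rewrite ler_norml.
have cst (r : R) : continuous (fun _ : circle R => r : R^o).
  by move=> z; exact: (@cst_continuous _ R^o).
have : circle_mean g <= circle_mean (fun=> g x + e).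
  apply: (le_circle_mean cg (cst _)) => y; have := osc x y.
  by rewrite ler_norml; lra.
have : circle_mean (fun=> g x - e) <= circle_mean g.
  apply: (le_circle_mean (cst _) cg) => y; have := osc x y.
  by rewrite ler_norml; lra.
by rewrite g0 !circle_mean_cst; lra.
Qed.

End Mean.

(** * Scalar-valued functions *)

Section Scalars.
Context {R : realType} {k : scalar_field}.
Implicit Types h : circle R -> scalars R k.

Lemma Re_le_norm (z : Rcomplex R) : `|complex.Re z| <= `|z|.
Proof. by case: z => x y /=; rewrite -sqrtr_sqr ler_wsqrtr// lerDl sqr_ge0. Qed.

Lemma Im_le_norm (z : Rcomplex R) : `|complex.Im z| <= `|z|.
Proof. by case: z => x y /=; rewrite -sqrtr_sqr ler_wsqrtr// lerDr sqr_ge0. Qed.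

Lemma norm_le_ReIm (z : Rcomplex R) :
  `|z| <= `|complex.Re z| + `|complex.Im z|.
Proof.
case: z => x y; apply: (@le_trans _ _ (Num.sqrt ((`|x| + `|y|) ^+ 2))).
  rewrite ler_wsqrtr// sqrrD !real_normK ?num_real//.
  by rewrite addrAC lerDl mulrn_wge0// mulr_ge0.
by rewrite sqrtr_sqr ger0_norm// addr_ge0.
Qed.

Definition scalar_of : R -> scalars R k :=
  match k return R -> scalars R k with
  | RealScalars => fun r => r
  | ComplexScalars => fun r => (r +i* 0)%C
  end.

Lemma scalar_ofD (r s : R) : scalar_of (r + s) = scalar_of r + scalar_of s.
Proof. by rewrite /scalar_of; case: k => //; congr Complex; rewrite ?addr0. Qed.

Lemma scalar_ofN (r : R) : scalar_of (- r) = - scalar_of r.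
Proof. by rewrite /scalar_of; case: k => //; congr Complex; rewrite ?oppr0. Qed.

Lemma scalar_of_norm (r : R) : `|scalar_of r| = `|r|.
Proof.
rewrite /scalar_of; case: k => //=.
by rewrite /Num.norm /= expr0n /= addr0 sqrtr_sqr.
Qed.

Lemma continuous_distP (V : pseudoMetricNormedZmodType R) (h : circle R -> V) :
  continuous h <-> forall x (e : R), 0 < e ->
    exists2 d : R, 0 < d & forall y, circle_dist x y < d -> `|h x - h y| < e.
Proof.
split=> [ch x e e0|ch x].
  have /cvgrPdist_lt/(_ _ e0) := ch x.
  move=> /nbhs_ballP[d d0 hd]; exists d => //.
apply/(@cvgrPdist_lt _ _ _ _ (nbhs_filter x)) => e e0; have [d d0 hd] := ch x e e0.
by apply/nbhs_ballP; exists d => // y; rewrite ballEmdist => /hd.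
Qed.

Lemma continuous_lip (V : pseudoMetricNormedZmodType R) (h : circle R -> V) (C : R) :
  (forall x y, `|h x - h y| <= C * circle_dist x y) -> continuous h.
Proof.
move=> hC; apply/continuous_distP => x e e0.
have C1 : 0 < `|C| + 1 by rewrite ltr_wpDl.
exists (e / (`|C| + 1)); first by rewrite divr_gt0.
move=> y; rewrite ltr_pdivlMr// mulrC; apply: le_lt_trans.
rewrite (le_trans (hC x y))// ler_wpM2r ?circle_norm_ge0//.
by rewrite (le_trans (ler_norm C))// lerDl.
Qed.

Lemma continuous_scalar_of (g : circle R -> R) :
  continuous (g : circle R -> R^o) -> continuous (fun x => scalar_of (g x)).
Proof.
move=> /continuous_distP cg; apply/continuous_distP => x e /(cg x)[d d0 gd].
exists d => // y /gd; rewrite -scalar_ofN -scalar_ofD scalar_of_norm.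
by [].
Qed.

Lemma continuous_scalarD h1 h2 : continuous h1 -> continuous h2 ->
  continuous (fun x => h1 x + h2 x).
Proof.
move=> c1 c2 x.
exact: (@cvgD _ _ _ _ (nbhs_filter x) _ _ _ _ (c1 x) (c2 x)).
Qed.

Lemma continuous_rotation (V : pseudoMetricNormedZmodType R) (h : circle R -> V) c :
  continuous h -> continuous (fun x => h (x + c)).
Proof.
move=> /continuous_distP ch; apply/continuous_distP => x e e0.
have [d d0 hd] := ch (x + c) e e0; exists d => // y xy.
by apply: hd; rewrite circle_dist_addr.
Qed.

Lemma continuous_birkhoff_sum n (alpha : R) h : continuous h ->
  continuous (birkhoff_sum n alpha h).
Proof.
move=> ch; elim: n => [|n IH]; rewrite /birkhoff_sum.
  by under eq_fun do rewrite big_nil; exact: cst_continuous.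
under eq_fun do rewrite big_nat_recr//=.
by apply: continuous_scalarD => //; exact: continuous_rotation.
Qed.

End Scalars.

Section Components.
Context {R : realType}.

Lemma continuous_Re (h : circle R -> scalars R ComplexScalars) : continuous h ->
  continuous ((fun x => complex.Re (h x)) : circle R -> R^o).
Proof.
move=> /continuous_distP ch; apply/continuous_distP => x e /(ch x)[d d0 hd].
exists d => // y /hd; apply: le_lt_trans.
by rewrite -(raddfB (@complex.Re R : Rcomplex R -> R)) Re_le_norm.
Qed.

Lemma continuous_Im (h : circle R -> scalars R ComplexScalars) : continuous h ->
  continuous ((fun x => complex.Im (h x)) : circle R -> R^o).
Proof.
move=> /continuous_distP ch; apply/continuous_distP => x e /(ch x)[d d0 hd].
exists d => // y /hd; apply: le_lt_trans.
by rewrite -(raddfB (@complex.Im R : Rcomplex R -> R)) Im_le_norm.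
Qed.

End Components.

Section ZeroMean.
Context {R : realType} {k : scalar_field}.
Implicit Types h : circle R -> scalars R k.

Lemma zero_meanD h1 h2 : continuous h1 -> continuous h2 ->
  zero_mean h1 -> zero_mean h2 -> zero_mean (fun x => h1 x + h2 x).
Proof.
case: k h1 h2 => h1 h2 c1 c2 /= m1 m2; first by rewrite circle_meanD// m1 m2 addr0.
have [[m1r m1i] [m2r m2i]] := (m1, m2).
under eq_fun do rewrite (raddfD (@complex.Re R : Rcomplex R -> R)).
under [in X in _ /\ X]eq_fun do rewrite (raddfD (@complex.Im R : Rcomplex R -> R)).
rewrite !circle_meanD; try exact: continuous_Re; try exact: continuous_Im.
by rewrite m1r m1i m2r m2i addr0.
Qed.

Lemma zero_mean_rotation h (c : circle R) : continuous h -> zero_mean h ->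
  zero_mean (fun x => h (x + c)).
Proof.
case: k h => h ch /= m; first by rewrite circle_mean_rotation.
rewrite (circle_mean_rotation c (continuous_Re ch)).
by rewrite (circle_mean_rotation c (continuous_Im ch)).
Qed.

Lemma zero_mean_scalar_of (g : circle R -> R) : circle_mean g = 0 ->
  zero_mean (fun x => scalar_of (k := k) (g x)).
Proof. by case: k => /= g0; rewrite ?circle_mean_cst. Qed.

Lemma zero_mean_birkhoff_sum n (alpha : R) h : continuous h -> zero_mean h ->
  zero_mean (birkhoff_sum n alpha h).
Proof.
move=> ch mh; elim: n => [|n IH]; rewrite /birkhoff_sum.
  under eq_fun do rewrite big_nil.
  by case: k => /=; rewrite ?circle_mean_cst.
under eq_fun do rewrite big_nat_recr//=.
apply: zero_meanD => //.
- exact: continuous_birkhoff_sum.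
- exact: continuous_rotation.
- exact: zero_mean_rotation.
Qed.

(** Real and imaginary parts are bounded separately, whence the factor 2. *)
Lemma zero_mean_norm_le_osc h (e : R) : continuous h -> zero_mean h ->
  (forall x y, `|h x - h y| <= e) -> forall x, `|h x| <= e *+ 2.
Proof.
case: k h => h ch mh osc x.
  apply: le_trans (zero_mean_le_osc ch mh osc x) _.
  by rewrite mulr2n lerDl (le_trans _ (osc x x)).
have [mr mi] := mh; rewrite (le_trans (norm_le_ReIm _))// mulr2n lerD//.
  apply: (zero_mean_le_osc (continuous_Re ch) mr) => y z.
  rewrite -(raddfB (@complex.Re R : Rcomplex R -> R)).
  exact: le_trans (Re_le_norm _) (osc y z).
apply: (zero_mean_le_osc (continuous_Im ch) mi) => y z.
rewrite -(raddfB (@complex.Im R : Rcomplex R -> R)).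
exact: le_trans (Im_le_norm _) (osc y z).
Qed.

End ZeroMean.

(** * Birkhoff sums *)

Section Birkhoff.
Context {R : realType} {k : scalar_field}.
Implicit Types f h : circle R -> scalars R k.

Lemma birkhoff_sumE n (alpha : R) f x :
  birkhoff_sum n alpha f x = \sum_(0 <= j < n) f (x + to_circle alpha *+ j).
Proof.
by apply: eq_big_nat => j _; rewrite mulr_natl to_circleMn.
Qed.

Lemma birkhoff_sumB n (alpha : R) f h x :
  birkhoff_sum n alpha f x - birkhoff_sum n alpha h x =
  \sum_(0 <= j < n) (f (x + to_circle alpha *+ j) - h (x + to_circle alpha *+ j)).
Proof. by rewrite !birkhoff_sumE sumrB. Qed.

Lemma norm_sum_le (V : normedZmodType R) n (u : nat -> V) (e : R) :
  (forall j, `|u j| <= e) -> `|\sum_(0 <= j < n) u j| <= n%:R * e.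
Proof.
move=> ue; rewrite (le_trans (ler_norm_sum _ _ _))//.
rewrite (le_trans (ler_sum _ (fun j _ => ue j)))//.
by rewrite big_const_nat iter_addr subn0 addr0 mulr_natl.
Qed.

Lemma birkhoff_sum_step n (alpha : R) f x :
  birkhoff_sum n alpha f (x + to_circle alpha) - birkhoff_sum n alpha f x =
  f (x + to_circle alpha *+ n) - f x.
Proof.
rewrite !birkhoff_sumE -sumrB.
under eq_bigr do rewrite -addrA -mulrS.
by rewrite (telescope_sumr (fun j => f (x + to_circle alpha *+ j)))// addr0.
Qed.

(** Each of the [j] unit shifts drops one value of [f] from the sum and adds another. *)
Lemma birkhoff_sum_shift_le n j (alpha : R) f (B : R) x :
  (forall y, `|f y| <= B) ->
  `|birkhoff_sum n alpha f (x + to_circle alpha *+ j) - birkhoff_sum n alpha f x|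
  <= j%:R * (B *+ 2).
Proof.
move=> fB; pose u i := birkhoff_sum n alpha f (x + to_circle alpha *+ i).
have -> : birkhoff_sum n alpha f x = u 0%N by rewrite /u addr0.
rewrite -/(u j) -(telescope_sumr u)//; apply: norm_sum_le => i.
rewrite /u mulrSr addrA birkhoff_sum_step.
by rewrite (le_trans (ler_normB _ _))// mulr2n lerD.
Qed.

Lemma birkhoff_sum_coboundary n (alpha c : R) (phi : circle R -> R) x :
  birkhoff_sum n alpha
    (fun y => scalar_of (k := k) (c * (phi (y + to_circle alpha) - phi y))) x =
  scalar_of (c * (phi (x + to_circle alpha *+ n) - phi x)).
Proof.
rewrite birkhoff_sumE; elim: n => [|n IH].
  by rewrite big_nil addr0 subrr mulr0 /scalar_of; case: k.
rewrite big_nat_recr//= IH -scalar_ofD -mulrDr -[x + _ + _]addrA -mulrSr.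
by rewrite [X in c * X]addrC subrKA.
Qed.

Lemma circle_unif_continuous f : continuous f -> forall e : R, 0 < e ->
  exists2 d : R, 0 < d & forall x y, circle_dist x y < d -> `|f x - f y| < e.
Proof.
move=> /continuous_distP cf e e0.
(* Compactness in covering form, with the scale as parameter: near each [x] and at all small scales,
   both values of [f] are within [e / 2] of [f x]. *)
have := (compact_near_coveringP [set: circle R]).1 circle_compact R (0^'+)
  (fun d x => forall y, circle_dist x y < d -> `|f x - f y| < e) _.
move=> /(_ _)[].
  move=> x _; have [d d0 fd] := cf x (e / 2) ltac:(by rewrite divr_gt0).
  exists (ball x (d / 2), [set t | 0 < t < d / 2]).
    split; first by apply: nbhsx_ballx; rewrite divr_gt0.
    near=> t; rewrite /=; apply/andP; split; near: t; first exact: nbhs_right_gt.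
    by apply: nbhs_right_lt; rewrite divr_gt0.
  move=> [z t] /= [xz /andP[t0 td]] y zy.
  move: xz; rewrite ballEmdist => xz.
  have fxz : `|f x - f z| < e / 2.
    by apply: fd; rewrite (lt_trans xz)// ltr_pdivrMr// ltr_pMr// ltr1n.
  have fxy : `|f x - f y| < e / 2.
    apply: fd; rewrite (le_lt_trans (circle_dist_triangle z _ _))// [d]splitr.
    by rewrite ltrD// (lt_trans zy).
  rewrite [e]splitr -(subrKA (f x)) (le_lt_trans (ler_normD _ _))//.
  by rewrite ltrD// distrC.
move=> d /= d0 fd; exists (d / 2); first by rewrite divr_gt0.
move=> x y; apply: (fd (d / 2)) => //=; last by rewrite divr_gt0.
by rewrite sub0r normrN gtr0_norm ?divr_gt0// ltr_pdivrMr// ltr_pMr// ltr1n.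
Unshelve. all: by end_near. Qed.

Lemma C0_bounded (f : C0 R k) : exists2 B : R, 0 <= B & forall x, `|f x| <= B.
Proof.
have m0 : zero_mean (fun _ : circle R => 0 : scalars R k).
  by case: k => /=; rewrite ?circle_mean_cst.
pose z := mkC0 (@cst_continuous _ _ 0) m0.
exists (C0_dist f z); last by move=> x; rewrite -[f x]subr0 (le_C0_dist f z).
by rewrite (le_trans _ (le_C0_dist f z 0)).
Qed.

(* The averages are equicontinuous and change little along an orbit segment of
   bounded length, and such segments are uniformly dense: so the averages have
   small oscillation, hence are close to their mean. *)
Lemma birkhoff_sum_sublinear (alpha : R) (f : C0 R k) :
  aperiodic (to_circle alpha) -> forall e : R, 0 < e ->
  exists N : nat, forall n x, (N <= n)%N -> `|birkhoff_sum n alpha f x| <= e * n%:R.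
Proof.
move=> apa e e0; have e40 : 0 < e / 4 by rewrite divr_gt0.
have [d d0 fd] := circle_unif_continuous (@C0_continuous _ _ f) e40.
have [L hit] := uniform_hit apa d0.
have [B B0 fB] := C0_bounded f.
(* From this index on, a shift by at most [L] steps changes the sum by at most [e / 4 * n]. *)
exists (Num.truncn (L%:R * (B *+ 2) / (e / 4))).+1 => n x Nn.
have LB : L%:R * (B *+ 2) <= e / 4 * n%:R.
  rewrite [leRHS]mulrC -ler_pdivrMr//.
  by rewrite (le_trans (ltW (truncnS_gt _)))// ler_nat.
(* One quarter of [e] pays for moving [y] along its orbit to within [d] of [z], another for uniform
   continuity; the factor 2 in [zero_mean_norm_le_osc] then restores [e]. *)
have osc y z : `|birkhoff_sum n alpha f y - birkhoff_sum n alpha f z| <=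
    e / 2 * n%:R.
  have [j jL yz] := hit (y - z).
  rewrite -(subrKA (birkhoff_sum n alpha f (y + to_circle alpha *+ j))).
  have -> : e / 2 * n%:R = e / 4 * n%:R + n%:R * (e / 4) by lra.
  rewrite (le_trans (ler_normD _ _))// lerD//.
    rewrite distrC (le_trans (birkhoff_sum_shift_le _ _ _ _ fB))//.
    by rewrite (le_trans _ LB)// ler_wpM2r ?mulrn_wge0// ler_nat.
  rewrite !birkhoff_sumE -sumrB; apply: norm_sum_le => i; apply/ltW/fd.
  by rewrite circle_dist_addr /circle_dist addrAC.
have := zero_mean_norm_le_osc
  (@continuous_birkhoff_sum _ _ n alpha _ (@C0_continuous _ _ f))
  (@zero_mean_birkhoff_sum _ _ n alpha _
     (@C0_continuous _ _ f) (@C0_zero_mean _ _ f)) osc x.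
by move=> /le_trans; apply; lra.
Qed.

End Birkhoff.

(** * Sets of Hausdorff dimension zero *)

Section HausdorffZero.
Context {R : realType} {T : metricType R}.
Local Open Scope ereal_scope.

Lemma nneseries_onth (X : Type) (s : seq X) (F : X -> R) :
  (forall p, (0 <= F p)%R) ->
  \sum_(0 <= j <oo) (if onth s j is Some p then (F p)%:E else 0) =
  (\sum_(p <- s) F p)%:E.
Proof.
move=> F0; rewrite (nneseries_split 0 (size s)); last first.
  by move=> j _; case: onth => // p; rewrite lee_fin.
rewrite add0n (@eseries0 _ _ (size s)) ?adde0; last first.
  by move=> j sj _; rewrite onth_default.
elim: s => [|p s IH]; first by rewrite !big_nil.
by rewrite [in RHS]big_cons [size _]/= big_nat_recl//= IH EFinD.
Qed.

(** Merges a sequence of covers into a single one of the same total cost; surjectivity of [g]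
    ensures that no piece is lost. *)
Lemma nneseries_pair (c : nat -> nat -> \bar R) : (forall i j, 0 <= c i j) ->
  exists g : nat -> nat * nat, (forall u, exists i, g i = u) /\
    \sum_(0 <= i <oo) c (g i).1 (g i).2 =
    \sum_(0 <= i <oo) \sum_(0 <= j <oo) c i j.
Proof.
move=> c0; have /ppcard_eqP[g] : ([set: nat] #= [set: nat * nat])%card.
  by rewrite card_eq_sym; exact: card_nat2.
have bij : bijective g := @bijTT _ _ g.
exists g; split.
  by case: bij => h _ hK u; exists (h u); rewrite hK.
rewrite [RHS]nneseries_esumT; last by move=> i; apply: nneseries_ge0.
transitivity (\esum_(l in [set: nat] `*` [set: nat]) c l.1 l.2).
  rewrite (reindex_esum [set: nat] _ g)//; first by rewrite nneseries_esumT.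
  by move: bij; rewrite -setTT_bijective -[in X in set_bij _ X _ -> _](@setXTT nat nat).
rewrite (_ : _ `*` _ = setT `*`` (fun=> setT)); last by apply/seteqP; split.
rewrite -(@esum_esum _ _ _ _ _ c)//.
by apply: eq_esum => i _; rewrite nneseries_esumT.
Qed.

Lemma diameter_ball (x : T) (r : R) : (0 < r)%R ->
  0 <= diameter (ball x r) <= (r *+ 2)%:E.
Proof.
move=> r0; apply/andP; split; first by apply: ereal_sup_ubound; left.
apply: ge_ereal_sup => _ [->|[[u v] [xu xv] <-]].
  by rewrite lee_fin mulrn_wge0// ltW.
move: xu xv; rewrite !ballEmdist /= => xu xv.
rewrite lee_fin (le_trans (metric_triangle u x v))// mulr2n lerD//; last exact: ltW.
by rewrite metric_sym ltW.
Qed.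

Lemma hausdorff_weight_ge0 s (A : set T) : 0 <= hausdorff_weight s A.
Proof. by rewrite /hausdorff_weight; case: ifP => // _; exact: poweR_ge0. Qed.

Lemma hausdorff_weight_ball s (x : T) (r : R) : (0 <= s)%R -> (0 < r)%R ->
  hausdorff_weight s (ball x r) <= ((r *+ 2) `^ s)%:E.
Proof.
move=> s0 r0; have /andP[d0 dr] := diameter_ball x r0.
rewrite /hausdorff_weight; case: ifP => _; first by rewrite lee_fin powR_ge0.
rewrite -poweR_EFin gt0_ler_poweR// in_itv/= ?leey ?d0//.
by rewrite lee_fin mulrn_wge0// ltW.
Qed.

Lemma hausdorff_premeasure_ge0 s d (A : set T) : 0 <= hausdorff_premeasure s d A.
Proof.
apply: le_ereal_inf_tmp => _ [U _ <-]; apply: nneseries_ge0 => i _ _.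
exact: hausdorff_weight_ge0.
Qed.

Lemma hausdorff_measure_eq0 s (A : set T) :
  (forall d, (0 < d)%R -> forall e, (0 < e)%R -> hausdorff_premeasure s d A <= e%:E) ->
  hausdorff_measure s A = 0.
Proof.
move=> small; apply/eqP; rewrite eq_le; apply/andP; split.
  apply: ge_ereal_sup => _ [d d0 <-]; apply/lee_addgt0Pr => e e0.
  by rewrite add0e small.
apply: le_trans (hausdorff_premeasure_ge0 s 1 A) _.
by apply: ereal_sup_ubound; exists 1%R => //=.
Qed.

Lemma hausdorff_dim_eq0 (A : set T) :
  (forall s, (0 < s)%R -> hausdorff_measure s A = 0) -> hausdorff_dim A = 0.
Proof.
move=> A0; apply/eqP; rewrite eq_le; apply/andP; split; last first.
  by apply: le_ereal_inf_tmp => _ [s [s0 _] <-]; rewrite lee_fin.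
apply/lee_addgt0Pr => e e0; rewrite add0e; apply: ereal_inf_lbound.
by exists e => //; split; [exact: ltW|exact: A0].
Qed.

(** With the exponent [m.+1], the tail from [M] on sums to exactly 2^-M. *)
Definition halves (m : nat) : R := (1 / (2 ^ m.+1)%:R)%R.

Lemma halves_gt0 m : (0 < halves m)%R.
Proof. by rewrite divr_gt0// ltr0n expn_gt0. Qed.

Lemma halves_le1 m : (halves m <= 1)%R.
Proof. by rewrite ler_pdivrMr ?ltr0n ?expn_gt0// mul1r ler1n expn_gt0. Qed.

(* A Borel-Cantelli argument: the exponents [halves m] tend to 0 and the costs
   [halves m] are summable. *)
Lemma hausdorff_dim_limsup_cover (A : set T) (V : nat -> seq (T * R)) :
  (forall m p, p \in V m -> (0 < p.2)%R) ->
  (forall m, (\sum_(p <- V m) (p.2 *+ 2) `^ halves m < halves m)%R) ->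
  (forall x, A x -> forall M, exists m p,
     [/\ (M <= m)%N, p \in V m & ball p.1 p.2 x]) ->
  hausdorff_dim A = 0.
Proof.
move=> V0 Vm VA; apply: hausdorff_dim_eq0 => s s0.
apply: hausdorff_measure_eq0 => d d0 e e0.
(* A choice of [M] with 2^-M below all three makes the exponents less than [s], the diameters less
   than [d] and the total cost less than [e] from index [M] on. *)
pose z := Num.min (Num.min s d) e.
have z0 : (0 < z)%R by rewrite !lt_min s0 d0 e0.
have [M _ Mz] := near_infty_natSinv_expn_lt (PosNum z0).
have {Mz} := Mz M (leqnn M); rewrite /= !lt_min -andbA => /and3P[Ms Md Me].
have hM n : (halves (M + n) < 1 / 2 ^+ M)%R.
  rewrite /halves !mul1r ltf_pV2 ?posrE ?exprn_gt0// ?ltr0n ?expn_gt0//.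
  by rewrite -natrX ltr_nat ltn_exp2l// ltnS leq_addr.
(* A single term of the sum is below [halves m <= 1], which forces [p.2 *+ 2 <= 1]; a power with
   exponent at most 1 does not decrease such a number, so the cost bounds the diameter. *)
have rad m p : p \in V m -> (p.2 *+ 2 <= halves m)%R.
  move=> pV; have p0 : (0 < p.2 *+ 2)%R by rewrite pmulrn_rgt0// (V0 _ _ pV).
  have ph : ((p.2 *+ 2) `^ halves m < halves m)%R.
    apply: le_lt_trans (Vm m); rewrite (big_rem p pV)/= lerDl.
    by apply: sumr_ge0 => ? _; exact: powR_ge0.
  have p1 : (p.2 *+ 2 <= 1)%R.
    rewrite leNgt; apply/negP => p1; move: ph; apply/negP; rewrite -leNgt.
    rewrite (le_trans (halves_le1 m))// -[leLHS](powRr0 (p.2 *+ 2)).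
    by rewrite ler_powR ?(ltW p1)// ltW// halves_gt0.
  by rewrite (le_trans _ (ltW ph))// ger1_powR ?p0// halves_le1.
pose c m j := if onth (V (M + m)%N) j is Some p
  then ((p.2 *+ 2) `^ halves (M + m)%N)%:E else 0.
have c0 m j : 0 <= c m j.
  by rewrite /c; case: onth => // p; rewrite lee_fin powR_ge0.
have onth_in l (p : T * R) j : onth l j = Some p -> p \in l.
  by move=> E; apply/onthP; exists j.
have [g [gsurj gsum]] := nneseries_pair c0.
pose U i := if onth (V (M + (g i).1)%N) (g i).2 is Some p
  then ball p.1 p.2 else set0 : set T.
apply: (@le_trans _ _ (\sum_(0 <= i <oo) hausdorff_weight s (U i))).
  apply: ereal_inf_lbound; exists U => //; split.
    move=> i; rewrite /U; case E: onth => [p|]; last first.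
      rewrite /diameter; apply: ge_ereal_sup => _ [->|[u [[]] _ _]].
      by rewrite lee_fin ltW.
    have pV := onth_in _ _ _ E.
    have /andP[_ dp] := diameter_ball p.1 (V0 _ _ pV).
    rewrite (le_trans dp)// lee_fin (le_trans (rad _ _ pV))//.
    by rewrite ltW// (lt_trans (hM _)).
  move=> x Ax; have [m [p [Mm pV px]]] := VA x Ax M.
  have /onthP[j jp] := pV.
  have [i gi] := gsurj ((m - M)%N, j).
  by exists i => //; rewrite /U gi /= subnKC// jp.
apply: (@le_trans _ _ (\sum_(0 <= i <oo) c (g i).1 (g i).2)).
  apply: lee_nneseries => [i _ _|i _]; first exact: hausdorff_weight_ge0.
  rewrite /U /c; case E: onth => [p|]; last first.
    by rewrite /hausdorff_weight asboolT.
  have pV := onth_in _ _ _ E; have p0 := V0 _ _ pV.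
  rewrite (le_trans (hausdorff_weight_ball _ (ltW s0) p0))// lee_fin.
  (* The base is at most 1, so the larger exponent [s] gives the smaller weight. *)
  apply: ger_powR; last by rewrite ltW// (lt_trans (hM _)).
  by rewrite pmulrn_rgt0//= (le_trans (rad _ _ pV))// halves_le1.
rewrite gsum.
apply: (@le_trans _ _ (\sum_(0 <= m <oo) (halves (M + m)%N)%:E)).
  apply: lee_nneseries => [m _ _|m _]; first exact: nneseries_ge0.
  by rewrite /c nneseries_onth ?lee_fin ?ltW// => p; exact: powR_ge0.
have -> : \sum_(0 <= m <oo) (halves (M + m)%N)%:E = (1 / 2 ^+ M)%:E.
  apply/cvg_lim => //; rewrite (_ : (fun n => _) =
    eseries (fun m => (1 / (2 ^ (m + M.+1))%:R)%:E)); last first.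
    by apply/funext => n; apply: eq_bigr => m _; rewrite /halves addnS addnC.
  exact: cvg_geometric_eseries_half.
by rewrite lee_fin ltW.
Qed.

End HausdorffZero.

(** * The residual set *)

Section SparseSlow.
Context {R : realType} {k : scalar_field}.
Variables (alpha : R) (psi : nat -> nat).

(** The balls in [s] confine the points that are slow at time [n]. The margin [g] is uniform in [x],
    and [m < n] sends the times to infinity with [m]. *)
Definition sparse_slow (m : nat) : set (C0 R k) :=
  [set f | exists n (g : R) (s : seq (circle R * R)),
    [/\ (m < n)%N, 0 < g, forall p, p \in s -> 0 < p.2,
      \sum_(p <- s) (p.2 *+ 2) `^ halves m < halves m &
      forall x, (forall p, p \in s -> p.2 <= circle_dist p.1 x) ->
        m%:R * (psi n)%:R + g <= `|birkhoff_sum n alpha f x|]].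

Lemma open_sparse_slow m : open (sparse_slow m).
Proof.
rewrite openE => f [n [g [s [mn g0 s0 sm fs]]]].
have n0 : 0 < n%:R :> R by rewrite ltr0n (leq_ltn_trans _ mn).
(* A sum of [n] terms moves by at most [n] times the sup distance, so this radius costs half of the
   margin while [n] and [s] stay the same. *)
apply/nbhs_ballP; exists (g / 2 / n%:R); first by rewrite /= !divr_gt0.
move=> h; rewrite ballEmdist /= => fh.
exists n, (g / 2), s; split=> //; first by rewrite divr_gt0.
move=> x /fs fx.
have : `|birkhoff_sum n alpha f x - birkhoff_sum n alpha h x| <= g / 2.
  rewrite birkhoff_sumB (le_trans (norm_sum_le n (e := g / 2 / n%:R) _))//.
    by move=> j; rewrite (le_trans (le_C0_dist f h _))// ltW.
  by rewrite mulrCA divff ?gt_eqF// mulr1.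
move=> /(le_trans (lerB_dist _ _)); lra.
Qed.

Hypothesis alpha_irr : irrational alpha.
Hypothesis psi_o : (fun n => (psi n)%:R : R^o) =o_\oo (fun n => n%:R : R^o).

Lemma dense_sparse_slow m : dense (sparse_slow m).
Proof.
have apa := irrational_aperiodic alpha_irr.
move=> O [f Of]; rewrite openE => /(_ f Of) /nbhs_ballP[e /= e0 feO].
(* Budget per unit of [n]: the coboundary brings [e / 2], small enough to stay in the ball of radius
   [e]; the sum of [f] takes at most [e / 4] and [m psi(n)] at most [e / 8], leaving a margin
   [e / 8]. Below, [m.+1] is a nonzero divisor even for [m = 0]. *)
have e20 : 0 < e / 2 by rewrite divr_gt0.
have e40 : 0 < e / 4 by rewrite divr_gt0.
have [N SN] := birkhoff_sum_sublinear f apa e40.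
have d0 : 0 < e / 8 / m.+1%:R by rewrite !divr_gt0.
have [N' _ psiN] : \forall n \near \oo,
    `|(psi n)%:R : R^o| <= e / 8 / m.+1%:R * `|n%:R : R^o|.
  by move: psi_o => /eqoP; apply.
pose n := (maxn m (maxn N N')).+1.
have mn : (m < n)%N by rewrite ltnS leq_maxl.
have Nn : (N <= n)%N by rewrite leqW// !leq_max leqnn orbT.
have {}psiN : (psi n)%:R <= e / 8 / m.+1%:R * n%:R :> R.
  have /psiN : (N' <= n)%N by rewrite leqW// !leq_max leqnn !orbT.
  by rewrite /= !ger0_norm.
have {}SN x := SN n x Nn.
have [phi [C [s [phiC phi1 s0 sm phin]]]] :=
  tower_function n apa (halves_gt0 m) (halves_gt0 (R := R) m).
set a := to_circle alpha in phi1 phin.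
have cphi : continuous (phi : circle R -> R^o) by exact: continuous_lip phiC.
pose v x := phi (x + a) - phi x.
have vC x y : `|v x - v y| <= (C + C) * circle_dist x y.
  have := phiC (x + a) (y + a); have := phiC x y; rewrite circle_dist_addr /v.
  by rewrite !ler_norml; lra.
have cv : continuous (v : circle R -> R^o) by exact: continuous_lip vC.
have cu : continuous ((fun x => e / 2 * v x) : circle R -> R^o).
  apply: (@continuous_lip _ _ _ (e / 2 * (C + C))) => x y; rewrite -mulrBr.
  by rewrite normrM gtr0_norm// -[leRHS]mulrA ler_pM2l.
have u0 : circle_mean (fun x => e / 2 * v x) = 0.
  rewrite circle_meanZ// circle_meanB//; last exact: continuous_rotation.
  by rewrite circle_mean_rotation// subrr mulr0.
have ch := continuous_scalarD (@C0_continuous _ _ f) (continuous_scalar_of (k := k) cu).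
have mh := zero_meanD (@C0_continuous _ _ f) (continuous_scalar_of (k := k) cu)
  (@C0_zero_mean _ _ f) (zero_mean_scalar_of (k := k) u0).
pose h := mkC0 ch mh.
exists h; split.
  apply: feO; rewrite ballEmdist /=; apply: (@le_lt_trans _ _ (e / 2)); last first.
    by rewrite ltr_pdivrMr// ltr_pMr// ltr1n.
  apply: C0_dist_le => x /=; rewrite opprD addrA subrr add0r normrN scalar_of_norm.
  by rewrite normrM gtr0_norm// ger_pMr// phi1.
have n0 : 0 < n%:R :> R by rewrite ltr0n.
exists n, (e / 8 * n%:R), s; split=> //; first by rewrite mulr_gt0// divr_gt0.
move=> x /phin phix.
have hE : birkhoff_sum n alpha h x = birkhoff_sum n alpha f x +
    birkhoff_sum n alpha (fun y => scalar_of (k := k) (e / 2 * v y)) x.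
  by rewrite !birkhoff_sumE -big_split.
have SuE : `|birkhoff_sum n alpha (fun y => scalar_of (k := k) (e / 2 * v y)) x| =
    e / 2 * n%:R.
  by rewrite birkhoff_sum_coboundary scalar_of_norm normrM gtr0_norm// phix.
have hn : e / 2 * n%:R <= `|birkhoff_sum n alpha h x| + e / 4 * n%:R.
  rewrite -SuE (_ : birkhoff_sum n alpha _ x =
    birkhoff_sum n alpha h x - birkhoff_sum n alpha f x).
    by rewrite (le_trans (ler_normB _ _))// lerD2l SN.
  by rewrite hE addrAC subrr add0r.
have mpsi : m%:R * (psi n)%:R <= e / 8 * n%:R.
  apply: (@le_trans _ _ (m.+1%:R * (psi n)%:R)); first by rewrite ler_wpM2r// ler_nat.
  rewrite (le_trans (ler_wpM2l _ psiN))// mulrA mulrCA divff ?mulr1//.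
by lra.
Qed.

End SparseSlow.

(** * From bounded quotients to dimension zero *)

Lemma limn_esup_lty {R : realType} (u : nat -> R) : (limn_esup (EFin \o u) < +oo)%E ->
  exists C N, forall n, (N <= n)%N -> u n <= C.
Proof.
rewrite limn_esup_lim (cvg_lim _ (@cvg_esups_inf _ _))// => /ereal_inf_lt.
move=> [_ [N _ <-] esN].
have : exists C, (esups (EFin \o u) N <= C%:E)%E.
  case: (esups (EFin \o u) N) esN => // [r|] _; first by exists r.
  by exists 0; rewrite leNye.
move=> [C uC]; exists C, N => n Nn; rewrite -lee_fin (le_trans _ uC)//.
by apply: ereal_sup_ubound; exists n.
Qed.

(** Outside the balls of level [m] a sum exceeds [m psi(n)], against the bound [C psi(n)] of a slow
    point once [m >= C]; so slow points lie in balls of arbitrarily large levels. *)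
Lemma hausdorff_dim_slow_growth {R : realType} {k : scalar_field} (alpha : R)
    (psi : nat -> nat) (f : C0 R k) : (forall n, (0 < n)%N -> (0 < psi n)%N) ->
  (forall m, sparse_slow alpha psi m f) ->
  hausdorff_dim (slow_growth_set alpha psi f) = 0%E.
Proof.
move=> psi0 fm.
have /choice[V VP] : forall m, exists s : seq (circle R * R), exists n g,
    [/\ (m < n)%N, 0 < g, forall p, p \in s -> 0 < p.2,
      \sum_(p <- s) (p.2 *+ 2) `^ halves m < halves m &
      forall x, (forall p, p \in s -> p.2 <= circle_dist p.1 x) ->
        m%:R * (psi n)%:R + g <= `|birkhoff_sum n alpha f x|].
  by move=> m; have [n [g [s sP]]] := fm m; exists s, n, g.
apply: (@hausdorff_dim_limsup_cover _ _ _ V) => [m p|m|x].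
- by have [? [? [_ _ + _ _]]] := VP m; apply.
- by have [? [? [_ _ _ + _]]] := VP m.
move=> /limn_esup_lty[C [N xC]] M.
(* One level meets three demands: at least [M], at least [N] so that the bound applies at [n > m],
   and at least [C]. *)
pose m := maxn M (maxn N (Num.truncn C).+1).
have [n [g [mn g0 V0 Vm fx]]] := VP m.
have Mm : (M <= m)%N by rewrite leq_maxl.
have Nm : (N <= m)%N by rewrite !leq_max leqnn orbT.
have Cm : C <= m%:R.
  by rewrite (le_trans (ltW (truncnS_gt _)))// ler_nat !leq_max leqnn !orbT.
have psin : 0 < (psi n)%:R :> R by rewrite ltr0n psi0// (leq_ltn_trans _ mn).
apply: contrapT => nox.
have /fx : forall p, p \in V m -> p.2 <= circle_dist p.1 x.
  move=> p pV; rewrite leNgt; apply/negP => px; apply: nox.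
  by exists m, p; split=> //; rewrite ballEmdist.
have := xC n (leq_trans Nm (ltnW mn)); rewrite ler_pdivrMr// => nC.
have : C * (psi n)%:R <= m%:R * (psi n)%:R by rewrite ler_pM2r.
by lra.
Qed.

Theorem theorem1p5 (R : realType) (k : scalar_field) (alpha : R)
    (alpha_irr : irrational alpha) (psi : nat -> nat)
    (psi_gt0 : forall n, (0 < n)%N -> (0 < psi n)%N)
    (psi_o : (fun n => (psi n)%:R : R^o) =o_\oo (fun n => n%:R : R^o)) :
  exists Res : set (C0 R k), residual Res /\
    forall f, Res f -> hausdorff_dim (slow_growth_set alpha psi f) = 0%E.
Proof.
exists (\bigcap_m sparse_slow alpha psi m); split.
  exists (sparse_slow alpha psi); split=> // m.
  by split; [exact: open_sparse_slow|exact: dense_sparse_slow].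
by move=> f fm; apply: hausdorff_dim_slow_growth => // m; exact: fm.
Qed.
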